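(* Let $n\ge 5$ and $N_1,N_2\ge 0$ be integers. The generating function $AQ_{-N_1}^{N_2}(n)(q,t)$ is $$\frac{\prod_{l=-2N_1}^{2N_2}(1-q^lt^2)}{\prod_{l=-N_1}^{N_2}(1-q^lt)^{n}}.$$
   Context: $AQ_{-N_1}^{N_2}(n)$ is the quotient of the polynomial ring $\mathbb{C}[\lambda^i[s]]$, $1\le i\le n$, $-N_1\le s\le N_2$, by the ideal generated by $$f[k]=\sum_{s+t=k}\sum_{i=1}^n\lambda^i[s]\lambda^i[t],\qquad -2N_1\le k\le 2N_2$$ ($s,t$ in the range $-N_1\le s,t\le N_2$). It is bigraded: $\lambda^i[s]$ has degree $1$ and weight $s$. Writing $AQ_{d,w}$ for the component of degree $d$ and weight $w$, the generating function is the formal power series in $t$ with coefficients in $\mathbb{Z}[q,q^{-1}]$ $$AQ_{-N_1}^{N_2}(n)(q,t)=\sum_{d\ge0}\sum_{w\in\mathbb{Z}}\dim_{\mathbb{C}}(AQ_{d,w})\,q^w t^d.$$ *)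

(* Defs.v *)
From HB Require Import structures.
From mathcomp Require Import all_boot all_order all_algebra.
From mathcomp Require Import boolp classical_sets functions cardinality fsbigop.
From mathcomp Require Import reals.
From mathcomp.real_closed Require Import complex.
From mathcomp Require Import mpoly.

Set Implicit Arguments.
Unset Strict Implicit.
Unset Printing Implicit Defensive.

Import GRing.Theory.
Local Open Scope quotient_scope.
Local Open Scope ring_scope.

Local Notation "x %:F" := (@FracField.tofrac _ x) : ring_scope.

(* Classical inversion, used to make any commutative ring a unit ring. *)
Section ClassicalUnits.
Variable A : comNzRingType.

Definition cunit (x : A) : bool := `[< exists y, y * x = 1 >].

Definition cinv (x : A) : A := xget x [set y | y * x = 1]%classic.

Lemma cmulVr : {in cunit, left_inverse 1 cinv *%R}.
Proof. by move=> x /asboolP[y yx]; rewrite /cinv; case: xgetP => // /(_ y). Qed.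

Lemma cunitPl (x y : A) : y * x = 1 -> cunit x.
Proof. by move=> yx; apply/asboolP; exists y. Qed.

Lemma cinv_out : {in [predC cunit], cinv =1 id}.
Proof.
move=> x /negP xNu; rewrite /cinv; case: xgetP => // y _ yx.
by case: xNu; apply: (cunitPl yx).
Qed.

End ClassicalUnits.

(* Formal power series A[[t]]. *)
Record fps (A : Type) := Fps { fps_coef : nat -> A }.

HB.instance Definition _ (A : Type) := [isNew for @fps_coef A].
HB.instance Definition _ (A : choiceType) := [Choice of fps A by <:].

Section FpsRing.
Variable A : comNzRingType.
Implicit Types f g h : fps A.

Lemma fpsP f g : (forall k, fps_coef f k = fps_coef g k) -> f = g.
Proof. by case: f g => [f] [g] /= fg; congr Fps; apply: funext. Qed.

Definition fps_add f g := Fps (fun k => fps_coef f k + fps_coef g k).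
Definition fps_opp f := Fps (fun k => - fps_coef f k).
Definition fpsC (a : A) := Fps (fun k => if k == 0 then a else 0).
Definition fpsX : fps A := Fps (fun k => (k == 1)%:R).
Definition fps_mul f g :=
  Fps (fun k => \sum_(i < k.+1) fps_coef f i * fps_coef g (k - i)).

Lemma fps_addA : associative fps_add.
Proof. by move=> f g h; apply: fpsP => k /=; rewrite addrA. Qed.
Lemma fps_addC : commutative fps_add.
Proof. by move=> f g; apply: fpsP => k /=; rewrite addrC. Qed.
Lemma fps_add0 : left_id (fpsC 0) fps_add.
Proof. by move=> f; apply: fpsP => k /=; rewrite if_same add0r. Qed.
Lemma fps_addN : left_inverse (fpsC 0) fps_opp fps_add.
Proof. by move=> f; apply: fpsP => k /=; rewrite if_same addNr. Qed.

HB.instance Definition _ :=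
  GRing.isZmodule.Build (fps A) fps_addA fps_addC fps_add0 fps_addN.

Let trunc m f : {poly A} := \poly_(i < m) fps_coef f i.

Let coef_fps_mul f g m k : (k < m)%N ->
  fps_coef (fps_mul f g) k = (trunc m f * trunc m g)`_k.
Proof.
move=> km; rewrite coefM /=; apply: eq_bigr => -[i /= ik] _.
rewrite !coef_poly (leq_ltn_trans (leq_subr _ _) km).
by rewrite (leq_ltn_trans _ km) // -ltnS.
Qed.

Lemma fps_mulA : associative fps_mul.
Proof.
move=> f g h; apply: fpsP => k.
rewrite !(@coef_fps_mul _ _ k.+1) //.
have tr u v j : (j < k.+1)%N ->
    (trunc k.+1 (fps_mul u v))`_j = (trunc k.+1 u * trunc k.+1 v)`_j.
  by move=> jk; rewrite coef_poly jk (@coef_fps_mul _ _ k.+1).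
transitivity ((trunc k.+1 f * (trunc k.+1 g * trunc k.+1 h))`_k).
  by rewrite !coefM; apply: eq_bigr => i _; rewrite tr // ltnS leq_subr.
by rewrite mulrA !coefM; apply: eq_bigr => i _; rewrite tr.
Qed.

Lemma fps_mulC : commutative fps_mul.
Proof.
by move=> f g; apply: fpsP => k; rewrite !(@coef_fps_mul _ _ k.+1) // mulrC.
Qed.

Lemma fps_mul1 : left_id (fpsC 1) fps_mul.
Proof.
move=> f; apply: fpsP => k /=; rewrite big_ord_recl /= mul1r subn0.
by rewrite big1 ?addr0 // => i _; rewrite mul0r.
Qed.

Lemma fps_mulDl : left_distributive fps_mul fps_add.
Proof.
move=> f g h; apply: fpsP => k /=; rewrite -big_split.
by apply: eq_bigr => i _; rewrite mulrDl.
Qed.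

Lemma fps_1neq0 : fpsC 1 != 0 :> fps A.
Proof. by apply/eqP => /(congr1 (@fps_coef A)) /(congr1 (@^~ 0))/eqP; rewrite oner_eq0. Qed.

HB.instance Definition _ := GRing.Zmodule_isComNzRing.Build (fps A)
  fps_mulA fps_mulC fps_mul1 fps_mulDl fps_1neq0.

HB.instance Definition _ := GRing.ComNzRing_hasMulInverse.Build (fps A)
  (@cmulVr (fps A)) (@cunitPl (fps A)) (@cinv_out (fps A)).

Lemma fps_unit f : fps_coef f 0 = 1 -> f \is a GRing.unit.
Proof.
move=> f0; pose h := 1 - f.
have hX k j : (j < k)%N -> fps_coef (h ^+ k) j = 0.
  elim: k j => // k IHk j jk; rewrite exprS /= big1 // => -[[|i] /= ij] _.
    by rewrite f0 subrr mul0r.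
  rewrite IHk ?mulr0 // ltn_subLR // addSn ltnS.
  by rewrite (leq_trans _ (leq_addl i k)).
have sumE m j (F : 'I_m -> fps A) :
    fps_coef (\sum_i F i) j = \sum_i fps_coef (F i) j.
  by elim/big_rec2: _ => [|i y1 y2 _ <- //]; rewrite /= if_same.
pose g := Fps (fun j => fps_coef (\sum_(k < j.+1) h ^+ k) j).
apply: (@cunitPl (fps A) f g); rewrite mulrC; apply: fpsP => m.
have gE j : (j < m.+1)%N -> fps_coef g j = fps_coef (\sum_(k < m.+1) h ^+ k) j.
  move=> jm; rewrite /g /= !sumE -(subnKC jm) big_split_ord /=.
  by rewrite [X in _ + X]big1 ?addr0 // => i _; rewrite hX ?leq_addr.
transitivity (fps_coef (f * \sum_(k < m.+1) h ^+ k) m).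
  by apply: eq_bigr => i _; rewrite gE // ltnS leq_subr.
have -> : f * (\sum_(k < m.+1) h ^+ k) = 1 - h ^+ m.+1.
  by rewrite -opprB subrX1 /h -mulNr opprB subKr.
by rewrite /= (hX m.+1 m) // oppr0 addr0.
Qed.

End FpsRing.

Arguments fpsX {A}.

(* Z[q, q^-1], as the subring of Z(q) of the fractions p(q) / q^k. *)
Definition laurent_pred : {pred {fraction {poly int}}} :=
  fun x => `[< exists p k, x = p%:F / ('X ^+ k)%:F >].

Fact laurent_subring : subring_closed laurent_pred.
Proof.
have X0 k : ('X ^+ k : {poly int})%:F != 0.
  by rewrite tofrac_eq0 expf_neq0 // polyX_eq0.
split.
- by apply/asboolP; exists 1, 0%N; rewrite expr0 divr1.
- move=> _ _ /asboolP[p [j ->]] /asboolP[r [k ->]]; apply/asboolP.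
  exists (p * 'X ^+ k - r * 'X ^+ j), (j + k)%N.
  by rewrite exprD rmorphB !rmorphM /= -[- (_ / _)]mulNr addf_div ?mulNr.
- move=> _ _ /asboolP[p [j ->]] /asboolP[r [k ->]]; apply/asboolP.
  by exists (p * r), (j + k)%N; rewrite exprD !rmorphM /= mulf_div.
Qed.

HB.instance Definition _ := GRing.isSubringClosed.Build {fraction {poly int}}
  laurent_pred laurent_subring.

Record laurent := Laurent
  { laurent_val :> {fraction {poly int}}; _ : laurent_val \in laurent_pred }.

HB.instance Definition _ := [isSub for laurent_val].
HB.instance Definition _ := [Choice of laurent by <:].
HB.instance Definition _ := [SubChoice_isSubComNzRing of laurent by <:].
HB.instance Definition _ := GRing.ComNzRing_hasMulInverse.Build laurent
  (@cmulVr laurent) (@cunitPl laurent) (@cinv_out laurent).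


Fact laurent_q_proof : 'X%:F \in laurent_pred.
Proof. by apply/asboolP; exists 'X, 0%N; rewrite expr0 divr1. Qed.
Definition lq : laurent := Laurent laurent_q_proof.

Lemma lq_unit : lq \is a GRing.unit.
Proof.
have V : ('X%:F)^-1 \in laurent_pred.
  by apply/asboolP; exists 1, 1%N; rewrite expr1 rmorph1 div1r.
apply: (@cunitPl laurent lq (Laurent V)); apply: val_inj => /=.
by rewrite mulVf // tofrac_eq0 polyX_eq0.
Qed.

(* The dimension of the subspace S of V (0 if S is infinite-dimensional). *)
Section Dimension.
Variables (K : fieldType) (V : lmodType K).

Definition is_basis (S : set V) (k : nat) (e : 'I_k -> V) : Prop :=
  [/\ forall i, S (e i),
      forall c : 'I_k -> K, \sum_i c i *: e i = 0 -> forall i, c i = 0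
    & forall v, S v -> exists c : 'I_k -> K, v = \sum_i c i *: e i].

Definition dimension (S : set V) : nat :=
  xget 0%N [set k | exists e : 'I_k -> V, is_basis S e]%classic.

End Dimension.

Definition ideal_gen (A : comNzRingType) (J : finType) (F : J -> A) : {pred A} :=
  fun p => `[< exists c : J -> A, p = \sum_j c j * F j >].

(* The index s in [-N1, N2] is encoded as s + N1 in 'I_(N1 + N2).+1; likewise
   k in [-2 N1, 2 N2] is encoded as k + 2 N1. *)
Section AQ.
Variables (R : realType) (n N1 N2 : nat).

Definition AQvar : finType := ('I_n * 'I_(N1 + N2).+1)%type.
Definition AQpoly := {mpoly R[i][#|{: AQvar}|]}.

Definition wt (s : 'I_(N1 + N2).+1) : int := s%:Z - N1%:Z.

Definition lam (i : 'I_n) (s : 'I_(N1 + N2).+1) : AQpoly :=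
  'X_(enum_rank ((i, s) : AQvar)).

Definition AQf (k : int) : AQpoly :=
  \sum_(st : 'I_(N1 + N2).+1 * 'I_(N1 + N2).+1 | wt st.1 + wt st.2 == k)
    \sum_(i < n) lam i st.1 * lam i st.2.

Definition AQideal : {pred AQpoly} :=
  ideal_gen (fun j : 'I_(2 * N1 + 2 * N2).+1 => AQf (j%:Z - (2 * N1)%:Z)).

Fact AQideal_closed : idealr_closed AQideal.
Proof.
split.
- by apply/asboolP; exists (fun=> 0); rewrite big1 // => j _; rewrite mul0r.
- apply/negP => /asboolP[c /(congr1 (mcoeff 0%MM))] /eqP.
  rewrite mcoeff1 eqxx raddf_sum /= big1 ?oner_eq0 // => j _.
  rewrite (rmorphM (mcoeff 0%MM)) /= /AQf raddf_sum big1 ?mulr0 // => st _ /=.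
  rewrite raddf_sum big1 // => i _ /=.
  by rewrite rmorphM /= mcoeffX -mdeg_eq0 mdeg1 mul0r.
- move=> a _ _ /asboolP[c ->] /asboolP[d ->]; apply/asboolP.
  exists (fun j => a * c j + d j); rewrite mulr_sumr -big_split /=.
  by apply: eq_bigr => j _; rewrite mulrDl mulrA.
Qed.

HB.instance Definition _ := isIdealr.Build AQpoly AQideal AQideal_closed.

Definition AQ : Type := {ideal_quot AQideal}.
HB.instance Definition _ := GRing.ComNzRing.on AQ.

Definition AQpi (p : AQpoly) : AQ := \pi_({ideal_quot AQideal}) p.

Fact AQpi_zmod_morphism : zmod_morphism AQpi.
Proof. exact: (rmorphB \pi_({ideal_quot AQideal})). Qed.
Fact AQpi_monoid_morphism : monoid_morphism AQpi.
Proof.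
split; first exact: (rmorph1 \pi_({ideal_quot AQideal})).
exact: (rmorphM \pi_({ideal_quot AQideal})).
Qed.
HB.instance Definition _ :=
  GRing.isZmodMorphism.Build AQpoly AQ AQpi AQpi_zmod_morphism.
HB.instance Definition _ :=
  GRing.isMonoidMorphism.Build AQpoly AQ AQpi AQpi_monoid_morphism.

Definition AQscale (a : R[i]) (x : AQ) : AQ := AQpi a%:MP * x.

Fact AQscaleA a b x : AQscale a (AQscale b x) = AQscale (a * b) x.
Proof. by rewrite /AQscale mulrA -rmorphM mpolyCM. Qed.
Fact AQscale1 : left_id 1 AQscale.
Proof. by move=> x; rewrite /AQscale mpolyC1 rmorph1 mul1r. Qed.
Fact AQscaleDr : right_distributive AQscale +%R.
Proof. by move=> a x y; rewrite /AQscale mulrDr. Qed.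
Fact AQscaleDl x : {morph AQscale^~ x : a b / a + b}.
Proof. by move=> a b; rewrite /AQscale mpolyCD rmorphD mulrDl. Qed.
HB.instance Definition _ := GRing.Zmodule_isLmodule.Build R[i] AQ
  AQscaleA AQscale1 AQscaleDr AQscaleDl.

Definition mono_weight (m : 'X_{1..#|{: AQvar}|}) : int :=
  \sum_(v : AQvar) (m (enum_rank v))%:Z * wt v.2.

Definition bihomog (d : nat) (w : int) : set AQpoly :=
  [set p | forall m, m \in msupp p -> mdeg m = d /\ mono_weight m = w]%classic.

Definition AQcomp (d : nat) (w : int) : set AQ := (AQpi @` bihomog d w)%classic.

(* For fixed d, only finitely many weights w contribute. *)
Definition AQgf : fps laurent :=
  Fps (fun d => \sum_(w \in [set: int]%classic) (dimension (AQcomp d w))%:R * lq ^ w).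

End AQ.

(* Main.v *)
(* Shift the indices so that s and k start at 0. Order monomials by an additive
   penalty for which every quadric f[k] has a unique monomial L_k of least
   penalty, chosen so that the L_k are pairwise coprime: L_k = lambda^i[a]
   lambda^i[b] with a = floor(k/2), b = ceil(k/2), the column i depending on
   a modulo 2 (k even: two columns) or modulo 3 (k odd: three more columns);
   this is where n >= 5 is used. By coprimality every monomial is uniquely u
   * prod_k L_k^(a_k) with u divisible by no L_k, and sending it to u *
   prod_k f[k]^(a_k) is a triangular, hence bijective, linear map. It
   carries multiplication by L_k to multiplication by f[k] and fixes the
   monomials u, so the latter form a basis of the quotient. Counting them
   removes the multiples of one L_k at a time, each step contributing a
   factor 1 - q^(k - 2 N1) t^2; removing the multiples of the variables in
   the same way gives the denominator. *)
Require Import Defs.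
From HB Require Import structures.
From mathcomp Require Import all_boot all_order all_algebra.
From mathcomp Require Import boolp classical_sets fsbigop.
From mathcomp Require Import reals zify.
From mathcomp.real_closed Require Import complex.
From mathcomp Require Import ssrcomplements mpoly.

Set Implicit Arguments.
Unset Strict Implicit.
Unset Printing Implicit Defensive.

Import Order.TTheory GRing.Theory Num.Theory.
Local Open Scope ring_scope.

(** * Factoring out pairwise coprime monomials *)

Section CoprimeMonomials.
Variables (n r : nat) (L : 'I_r -> 'X_{1..n}).
Hypothesis L_neq0 : forall j, L j != 0%MM.
Hypothesis L_coprime :
  forall i j v, i != j -> (L i v == 0%N) || (L j v == 0%N).
Implicit Types m : 'X_{1..n}.

Definition standard m := [forall j, ~~ (L j <= m)%MM].

(** The bound [mdeg m] loses nothing: a nonzero [L j] has positive degree. *)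
Definition expo m (j : 'I_r) : nat :=
  \max_(k < (mdeg m).+1 | (L j *+ k <= m)%MM) k.

Lemma leq_expo m j k : (k <= expo m j)%N = (L j *+ k <= m)%MM.
Proof.
apply/idP/idP => [kle | le_m].
  have P0 : (L j *+ (ord0 : 'I_(mdeg m).+1) <= m)%MM.
    by apply/mnm_lepP => v; rewrite mulmnE muln0.
  have [i Pi Ei] := eq_bigmax_cond (fun k : 'I_(mdeg m).+1 => k : nat)
    (ltac:(by apply/card_gt0P; exists ord0) :
      (0 < #|[pred k : 'I_(mdeg m).+1 | (L j *+ k <= m)%MM]|)%N).
  apply/mnm_lepP => v; move/mnm_lepP/(_ v): Pi => /=; apply: leq_trans.
  by rewrite !mulmnE leq_mul2l -Ei kle orbT.
have km : (k < (mdeg m).+1)%N.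
  rewrite ltnS -(submK le_m) mdegD mdegMn.
  apply: leq_trans (leq_addl _ _); rewrite leq_pmull // lt0n mdeg_eq0.
  exact: L_neq0.
exact: (@leq_bigmax_cond _ (fun k : 'I_(mdeg m).+1 => (L j *+ k <= m)%MM)
  (fun k => k : nat) (Ordinal km) le_m).
Qed.

(** Each variable is missing from [L i] or from [L j] when [i != j], so a factor [L i] cannot help a
    power of [L j] to divide. *)
Lemma expoDL m i j : expo (m + L i)%MM j = ((i == j) + expo m j)%N.
Proof.
have eq_leP a b : (forall k, (k <= a)%N = (k <= b)%N) -> a = b.
  by move=> ab; apply/eqP; rewrite eqn_leq -ab leqnn ab leqnn.
apply: eq_leP => -[|k]; rewrite ?leq0n //.
have [-> | nij] := eqVneq i j.
  rewrite add1n ltnS !leq_expo; apply/mnm_lepP/mnm_lepP => le v;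
    by move: (le v); rewrite mulmSr !mnmDE leq_add2r.
rewrite add0n !leq_expo; apply/mnm_lepP/mnm_lepP => le v; move: (le v);
  rewrite !mulmnE mnmDE; last by move/leq_trans; apply; rewrite leq_addr.
by case/orP: (L_coprime v nij) => /eqP ->; rewrite ?addn0.
Qed.

Definition remainder m := (m - \sum_j L j *+ expo m j)%MM.

(** At each variable at most one [L j] contributes to the sum, so the subtraction in [remainder]
    never truncates. *)
Lemma remainderK m : (remainder m + \sum_j L j *+ expo m j)%MM = m.
Proof.
apply: submK; apply/mnm_lepP => v; rewrite mnm_sumE.
case: (pickP (fun j => L j v != 0%N)) => [j Lj | L0]; last first.
  by rewrite big1 // => j _; rewrite mulmnE; move/eqP: (L0 j) => ->.
rewrite (bigD1 j) //= big1 => [|i ij].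
  by rewrite addn0; move: (leqnn (expo m j)); rewrite leq_expo => /mnm_lepP.
rewrite mulmnE; case/orP: (L_coprime v ij) => /eqP Li; first by rewrite Li.
by rewrite Li in Lj.
Qed.

Lemma remainderDL m i : remainder (m + L i)%MM = remainder m.
Proof.
apply: (@addIm _ (\sum_j L j *+ expo (m + L i) j)%MM).
rewrite remainderK -{1}(remainderK m) -addmA; congr (_ + _)%MM.
apply/mnmP => v; rewrite mnmDE !mnm_sumE (bigD1 i) //= [RHS](bigD1 i) //=.
rewrite addnAC; congr (_ + _)%N.
  by rewrite !mulmnE expoDL eqxx mulnDr muln1 addnC.
by apply: eq_bigr => j ji; rewrite !mulmnE expoDL eq_sym (negbTE ji).
Qed.

Lemma standard_expo m j : standard m -> expo m j = 0%N.
Proof.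
move/forallP/(_ j) => nle; apply/eqP; rewrite -leqn0 leqNgt leq_expo.
by rewrite mulm1n.
Qed.

Lemma standard_remainder m : standard m -> remainder m = m.
Proof.
move=> st; rewrite -[RHS]remainderK; apply/mnmP => v.
rewrite mnmDE mnm_sumE big1 ?addn0 // => j _.
by rewrite standard_expo ?mulm0n ?mnm0E.
Qed.

End CoprimeMonomials.

(** * Polynomials with coprime initial monomials *)

Section InitialMonomials.
Variables (K : fieldType) (n : nat).
Variables (pen : 'X_{1..n} -> nat) (W : 'X_{1..n} -> int) (C : nat).
Hypothesis penD : forall m m', pen (m + m')%MM = (pen m + pen m')%N.
Hypothesis WD : forall m m', W (m + m')%MM = W m + W m'.
Hypothesis pen_le : forall m, (pen m <= C * mdeg m)%N.
Implicit Types (m : 'X_{1..n}) (p q : {mpoly K[n]}).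

(** Only a strict partial order: distinct monomials of equal bidegree and penalty are
    incomparable. *)
Definition above m m' :=
  [&& mdeg m' == mdeg m, W m' == W m & (pen m < pen m')%N].

Definition initial p m :=
  p@_m != 0 /\ forall m', m' \in msupp p -> (m' == m) || above m m'.

Lemma initialX m : initial 'X_[m] m.
Proof.
split; first by rewrite mcoeffX eqxx oner_neq0.
by move=> m'; rewrite msuppX mem_seq1 => ->.
Qed.

(** Strictness in one factor makes the product strict, so in a product of polynomials a single pair
    of terms yields the product of the initial monomials. *)
Lemma above_add m m' k k' : (m' == m) || above m m' -> (k' == k) || above k k' ->
  ((m' + k')%MM == (m + k)%MM) && (m' == m) && (k' == k) ||
  above (m + k)%MM (m' + k')%MM.
Proof.
rewrite /above !mdegD !WD !penD.
case/orP=> [/eqP->|/and3P[/eqP-> /eqP-> lt_m]];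
  case/orP=> [/eqP->|/and3P[/eqP-> /eqP-> lt_k]]; rewrite !eqxx //=.
- by rewrite ltn_add2l lt_k orbT.
- by rewrite ltn_add2r lt_m orbT.
- by rewrite -addnS leq_add ?orbT // ltnW.
Qed.

Lemma above_irr m : above m m = false.
Proof. by rewrite /above ltnn !andbF. Qed.

Lemma initialM p q m k : initial p m -> initial q k -> initial (p * q) (m + k)%MM.
Proof.
move=> [pm pS] [qk qS]; split; last first.
  move=> _ /msuppM_le /allpairsP[[m' k'] [/= /pS m'P /qS k'P ->]].
  by case/orP: (above_add m'P k'P) => [/andP[/andP[-> ]] //|->]; rewrite orbT.
have mb : (mdeg m < (mdeg (m + k)).+1)%N by rewrite ltnS mdegD leq_addr.
have kb : (mdeg k < (mdeg (m + k)).+1)%N by rewrite ltnS mdegD leq_addl.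
rewrite mcoeffM (bigD1 (BMultinom mb, BMultinom kb)) //= big1.
  by rewrite addr0 mulf_neq0.
move=> [m' k'] /= /andP[/eqP E].
have [p0|] := eqVneq p@_m' 0; first by rewrite p0 mul0r.
have [q0|] := eqVneq q@_k' 0; first by rewrite q0 mulr0.
rewrite -!mcoeff_msupp => /qS k'P /pS m'P /negP[].
case/orP: (above_add m'P k'P); last by rewrite -E above_irr.
by case/andP=> /andP[_ mm'] kk'; apply/eqP; congr pair; apply/val_inj/eqP.
Qed.

Lemma initial_prod (I : finType) (F : I -> {mpoly K[n]}) (M : I -> 'X_{1..n}) :
  (forall i, initial (F i) (M i)) -> initial (\prod_i F i) (\sum_i M i)%MM.
Proof.
move=> FM; elim/big_rec2: _ => [|i m p _]; last exact: initialM.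
by rewrite -mpolyX0; apply: initialX.
Qed.

Lemma initial_exp p m k : initial p m -> initial (p ^+ k) (m *+ k)%MM.
Proof.
move=> pm; elim: k => [|k IH]; last by rewrite exprS mulmS; apply: initialM.
by rewrite expr0 mulm0n -mpolyX0; apply: initialX.
Qed.

(** * The triangular map from products of the [L j] to products of the [f j] *)

Section Complete.
Variables (r : nat) (L : 'I_r -> 'X_{1..n}) (f : 'I_r -> {mpoly K[n]}).
Hypothesis L_neq0 : forall j, L j != 0%MM.
Hypothesis L_coprime :
  forall i j v, i != j -> (L i v == 0%N) || (L j v == 0%N).
Hypothesis f_initial : forall j, initial (f j) (L j).

Definition twist m := 'X_[remainder L m] * \prod_j f j ^+ expo L m j.

(** Triangularity: initial monomials multiply, and [m] is its remainder times its powers of the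
    [L j]. *)
Lemma twist_initial m : initial (twist m) m.
Proof.
rewrite -{2}(remainderK L_neq0 L_coprime m).
by apply/initialM/initial_prod => [|j]; [exact: initialX | exact: initial_exp].
Qed.

Lemma twistDL m i : twist (m + L i)%MM = twist m * f i.
Proof.
rewrite /twist remainderDL // -mulrA; congr (_ * _).
rewrite (bigD1 i) //= [in RHS](bigD1 i) //= expoDL // eqxx exprS.
rewrite -mulrA mulrC; congr (_ * _ * _).
by apply: eq_bigr => j ji; rewrite expoDL // eq_sym (negbTE ji).
Qed.

Lemma twist_standard m : standard L m -> twist m = 'X_[m].
Proof.
move=> st; rewrite /twist standard_remainder // big1 ?mulr1 // => j _.
by rewrite standard_expo.
Qed.

Definition unfoldf p := \sum_(m <- msupp p) p@_m *: twist m.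

(** A summation range common to several polynomials makes linearity a termwise computation. *)
Lemma unfoldfE p k : (msize p <= k)%N ->
  unfoldf p = \sum_(m : 'X_{1..n < k}) p@_m *: twist m.
Proof.
move=> le_pk; rewrite /unfoldf (big_mksub 'X_{1..n < k}) ?msupp_uniq //=.
  by rewrite big_rmcond //= => m /memN_msupp_eq0 ->; rewrite scale0r.
by move=> m /msize_mdeg_lt /leq_trans; apply.
Qed.

Fact unfoldf_linear : linear unfoldf.
Proof.
move=> a p q; pose k := maxn (msize (a *: p + q)) (maxn (msize p) (msize q)).
rewrite !(@unfoldfE _ k) ?leq_max ?leqnn ?orbT // scaler_sumr -big_split /=.
by apply: eq_bigr => m _; rewrite mcoeffD mcoeffZ scalerDl scalerA.
Qed.
HB.instance Definition _ :=
  GRing.isLinear.Build K {mpoly K[n]} {mpoly K[n]} _ unfoldf unfoldf_linear.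

Lemma unfoldfX m : unfoldf 'X_[m] = twist m.
Proof. by rewrite /unfoldf msuppX big_seq1 mcoeffX eqxx scale1r. Qed.

Lemma unfoldfML p i : unfoldf (p * 'X_[L i]) = unfoldf p * f i.
Proof.
rewrite {1}(mpolyE p) mulr_suml linear_sum /unfoldf mulr_suml.
apply: eq_bigr => m _.
by rewrite -scalerAl -mpolyXD linearZ /= unfoldfX twistDL scalerAl.
Qed.

Lemma unfoldf_standard p : {in msupp p, forall m, standard L m} -> unfoldf p = p.
Proof.
move=> st; rewrite [RHS]mpolyE; apply: eq_big_seq => m /st mS.
by rewrite twist_standard.
Qed.

(** A monomial of least penalty in [p] survives: for any other [m'] in the support, [twist m']
    involves besides [m'] only penalties above [pen m']. *)
Lemma unfoldf_inj : injective unfoldf.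
Proof.
apply: raddf_inj => p p0; apply/eqP/negPn/negP => pN.
have [m mp min_m] : exists2 m, m \in msupp p &
    forall m', m' \in msupp p -> (pen m <= pen m')%N.
  have ex : exists k, [exists i : 'I_(size (msupp p)),
      pen (nth 0%MM (msupp p) i) == k].
    have s0 : (0 < size (msupp p))%N by rewrite lt0n size_eq0 msupp_eq0.
    exists (pen (nth 0%MM (msupp p) (Ordinal s0))).
    by apply/existsP; exists (Ordinal s0).
  case: (ex_minnP ex) => k /existsP[i /eqP <-] kmin.
  exists (nth 0%MM (msupp p) i); first exact: mem_nth.
  move=> m' /(nthP 0%MM)[j jlt <-]; apply: kmin.
  by apply/existsP; exists (Ordinal jlt).
move/(congr1 (mcoeff m)): p0; rewrite mcoeff0 /unfoldf raddf_sum /=.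
rewrite (bigD1_seq m) ?msupp_uniq //= big_seq_cond big1 => [/eqP|m'].
  rewrite addr0 mcoeffZ mulf_eq0 mcoeff_eq0 mp /=.
  by case: (twist_initial m) => /negP.
case/andP=> /min_m le_m nmm'; rewrite mcoeffZ.
have [->|] := eqVneq (twist m')@_m 0; first by rewrite mulr0.
rewrite -mcoeff_msupp => /(proj2 (twist_initial m')).
by rewrite eq_sym (negbTE nmm') /above ltnNge le_m !andbF.
Qed.

Definition bihom d w p := forall m, m \in msupp p -> mdeg m = d /\ W m = w.

Lemma bihom0 d w : bihom d w 0.
Proof. by move=> m; rewrite msupp0. Qed.

Lemma bihomD d w p q : bihom d w p -> bihom d w q -> bihom d w (p + q).
Proof. by move=> ph qh m /msuppD_le; rewrite mem_cat => /orP[/ph|/qh]. Qed.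

Lemma bihomZ d w a p : bihom d w p -> bihom d w (a *: p).
Proof. by move=> ph m /msuppZ_le /ph. Qed.

(** Solves a triangular system: the tail of [twist m] has larger penalty than [m], and in degree [d]
    penalties are at most [C * d], so the substitution terminates. *)
Lemma unfoldf_onto d w p : bihom d w p -> exists2 c, bihom d w c & p = unfoldf c.
Proof.
have lin (s : seq 'X_{1..n}) (a : 'X_{1..n} -> K) :
    {in s, forall m, exists2 c, bihom d w c & 'X_[m] = unfoldf c} ->
    exists2 c, bihom d w c & \sum_(m <- s) a m *: 'X_[m] = unfoldf c.
  elim: s => [|m s IH] sP.
    by exists 0; [exact: bihom0 | rewrite big_nil raddf0].
  have [c cd Ec] := sP m (mem_head _ _).
  have [|c' c'd Ec'] := IH.
    by move=> m' m's; apply: sP; rewrite in_cons m's orbT.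
  exists (a m *: c + c'); first by apply/bihomD => //; apply: bihomZ.
  by rewrite big_cons Ec Ec' linearP.
suff X m : mdeg m = d -> W m = w ->
    exists2 c, bihom d w c & 'X_[m] = unfoldf c.
  by move=> pd; rewrite [p]mpolyE; apply: lin => m /pd[]; apply: X.
have [k] := ubnP (C * d - pen m); elim: k m => // k IH m mk md mw.
have [tm tS] := twist_initial m.
set t := twist m in tm tS.
have [|c cd Ec] := lin (rem m (msupp t)) (fun m => t@_m).
  move=> m'; rewrite mem_rem_uniq ?msupp_uniq // inE => /andP[m'm /tS].
  rewrite (negbTE m'm) /= => /and3P[/eqP m'd /eqP m'w pp].
  apply: IH; rewrite ?m'd ?m'w //.
  by have := pen_le m'; rewrite m'd md; lia.
(* Here [t] is [unfoldf 'X_[m]] and its tail is [unfoldf c]; their difference is the initial term of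
   [t]. *)
exists ((t@_m)^-1 *: ('X_[m] - c)).
  apply/bihomZ/bihomD; last by rewrite -scaleN1r; apply: bihomZ.
  by move=> m'; rewrite msuppX mem_seq1 => /eqP->.
rewrite linearZ linearB /= unfoldfX -/t -Ec.
have mt : m \in msupp t by rewrite mcoeff_msupp; exact: tm.
rewrite {2}[t]mpolyE (perm_big _ (perm_to_rem mt)) /=.
by rewrite big_cons addrK scalerA mulVf // scale1r.
Qed.

(* Under [unfoldf], which fixes [p], the ideal of the [f j] comes from the
   monomial ideal of the [L j], which contains no standard monomial. *)
Lemma standard_ideal p (c : 'I_r -> {mpoly K[n]}) :
  {in msupp p, forall m, standard L m} -> p = \sum_j c j * f j -> p = 0.
Proof.
move=> pS pE.
(* Surjectivity passes to all polynomials because each monomial is bihomogeneous. *)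
have onto q : exists q', q = unfoldf q'.
  elim/mpolyind: q => [|a m q _ _ [q' ->]]; first by exists 0; rewrite raddf0.
  have [|c' _ ->] := @unfoldf_onto (mdeg m) (W m) 'X_[m].
    by move=> m'; rewrite msuppX mem_seq1 => /eqP->.
  by exists (a *: c' + q'); rewrite linearP.
have [c' cE] := boolp.choice (fun j => onto (c j)).
have : unfoldf p = unfoldf (\sum_j c' j * 'X_[L j]).
  rewrite unfoldf_standard // {1}pE linear_sum; apply: eq_bigr => j _.
  by rewrite /= unfoldfML cE.
move/unfoldf_inj => {}pE; apply/eqP; rewrite -msupp_eq0.
case E: (msupp p) => [//|m s].
have mp : m \in msupp p by rewrite E mem_head.
move: (mp); rewrite {1}pE => /msupp_sum_le /flattenP[s' /mapP[j _ ->]].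
rewrite (perm_mem (msuppMX _ _)) => /mapP[m' _ mE].
by move/pS/forallP/(_ j): mp; rewrite mE lem_addr.
Qed.

(** With [p = unfoldf c], the standard monomials of [c] make up [q]; every other one gives a
    multiple of some [f i] by [twistDL]. *)
Lemma standard_reduction d w p : bihom d w p ->
  exists q (c : 'I_r -> {mpoly K[n]}), [/\ bihom d w q,
    {in msupp q, forall m, standard L m} & p = q + \sum_j c j * f j].
Proof.
move/unfoldf_onto=> [c cd ->]; rewrite /unfoldf.
have {cd} := cd; rewrite /bihom; elim: (msupp c) => [|m s IH] sP.
  exists 0, (fun=> 0); split; [exact: bihom0 | by move=> m; rewrite msupp0 |].
  by rewrite big_nil add0r big1 // => j _; rewrite mul0r.
have [|q [e [qd qS qE]]] := IH.
  by move=> m' m's; apply: sP; rewrite in_cons m's orbT.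
rewrite big_cons qE.
have [st|] := boolP (standard L m).
  exists (c@_m *: 'X_[m] + q), e; split; last by rewrite twist_standard // addrA.
    apply: bihomD qd; apply: bihomZ => m'; rewrite msuppX mem_seq1 => /eqP->.
    exact/sP/mem_head.
  move=> m' /msuppD_le; rewrite mem_cat => /orP[|/qS //].
  by move/msuppZ_le; rewrite msuppX mem_seq1 => /eqP->.
case/forallPn=> i; rewrite negbK => /submK mE.
exists q, (fun j => e j + (j == i)%:R * (c@_m *: twist (m - L i)%MM)).
have -> : twist m = twist (m - L i)%MM * f i by rewrite -twistDL mE.
split=> //; rewrite addrCA; congr (_ + _).
under [RHS]eq_bigr do rewrite mulrDl.
rewrite big_split /= addrC; congr (_ + _).
rewrite (bigD1 i) //= big1 => [|j /negbTE->]; last by rewrite mul0r mul0r.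
by rewrite eqxx mul1r addr0 scalerAl.
Qed.

End Complete.
End InitialMonomials.

(** * Counting monomials *)

Section MonomialSeries.
Variables (n : nat) (A : comNzRingType) (Q : 'X_{1..n} -> A).
Hypothesis QD : forall m m', Q (m + m')%MM = Q m * Q m'.
Hypothesis Q0 : Q 0%MM = 1.
Implicit Types (m : 'X_{1..n}) (P : pred 'X_{1..n}).

Definition monomials (d : nat) : seq 'X_{1..n} :=
  [seq bmnm m | m : 'X_{1..n < d.+1} <- enum {: 'X_{1..n < d.+1}} & mdeg m == d].

Lemma mem_monomials d m : (m \in monomials d) = (mdeg m == d).
Proof.
apply/mapP/idP => [[m' + ->]|md]; first by rewrite mem_filter => /andP[].
have mlt : (mdeg m < d.+1)%N by rewrite (eqP md).
by exists (BMultinom mlt); rewrite // mem_filter mem_enum andbT.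
Qed.

Lemma monomials_uniq d : uniq (monomials d).
Proof.
by rewrite map_inj_uniq; [exact/filter_uniq/enum_uniq | exact: val_inj].
Qed.

Definition mseries P : fps A :=
  Fps (fun d => \sum_(m <- monomials d | P m) Q m).

Lemma coef_mulCXn (h : fps A) c a d :
  fps_coef (h * (fpsC c * fpsX ^+ a)) d =
    if (a <= d)%N then fps_coef h (d - a) * c else 0.
Proof.
have coefX e j : fps_coef (fpsX ^+ e : fps A) j = (j == e)%:R.
  elim: e j => [|e IH] j; first by rewrite expr0 /=; case: (j == 0%N).
  rewrite exprS /=; case: j => [|j].
    by rewrite big_ord1 /= mul0r.
  rewrite big_ord_recl big_ord_recl /= mul0r add0r mul1r big1.
    by rewrite addr0 IH /bump /= subn1.
  by move=> i _; rewrite /= mul0r.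
have coefCX j : fps_coef (fpsC c * fpsX ^+ a) j = c * (j == a)%:R.
  rewrite /= big_ord_recl /= coefX subn0 big1 ?addr0 // => i _.
  by rewrite mul0r.
have coefM (g : fps A) :
  fps_coef (h * g) d = \sum_(i < d.+1) fps_coef h i * fps_coef g (d - i) by [].
rewrite coefM; case: leqP => [ad|da]; last first.
  rewrite big1 // => i _; rewrite coefCX.
  by rewrite ltn_eqF ?mulr0 // (leq_ltn_trans (leq_subr _ _)).
have dalt : (d - a < d.+1)%N by rewrite ltnS leq_subr.
rewrite (bigD1 (Ordinal dalt)) // coefCX (subKn ad) eqxx mulr1 big1; first exact: addr0.
move=> i id; rewrite coefCX; case: eqP => [E|_]; last by rewrite !mulr0.
case/eqP: id; apply/val_inj => /=; have := ltn_ord i; lia.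
Qed.

(** Multiplication by [k] maps the monomials satisfying [P] bijectively onto those of them divisible
    by [k], which are then subtracted. *)
Lemma mseries_avoid P k : (forall m, P (m + k)%MM = P m) ->
  mseries [pred m | P m & ~~ (k <= m)%MM] =
    mseries P * (1 - fpsC (Q k) * fpsX ^+ mdeg k).
Proof.
move=> Pk; apply: fpsP => d; rewrite mulrBr mulr1.
rewrite -[RHS]/(fps_coef (mseries P) d -
  fps_coef (mseries P * (fpsC (Q k) * fpsX ^+ mdeg k)) d) coef_mulCXn /=.
rewrite (bigID (fun m => (k <= m)%MM) P) /= -[LHS]add0r -[RHS]addrAC.
congr (_ + _); apply/esym/eqP; rewrite subr_eq0; apply/eqP.
case: leqP => [kd|dk]; last first.
  rewrite big_seq_cond big1 // => m /and3P[]; rewrite mem_monomials => /eqP md _.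
  by move/submK=> mE; move: dk; rewrite -md -mE mdegD; lia.
rewrite mulr_suml -[LHS]big_filter.
have pm : perm_eq [seq m <- monomials d | P m && (k <= m)%MM]
    [seq (m + k)%MM | m <- monomials (d - mdeg k) & P m].
  apply: uniq_perm; first by rewrite filter_uniq ?monomials_uniq.
    by rewrite map_inj_uniq ?filter_uniq ?monomials_uniq //; apply: addIm.
  move=> m; rewrite mem_filter mem_monomials; apply/idP/mapP.
    case/andP=> /andP[Pm km] /eqP md; exists (m - k)%MM; last by rewrite submK.
    rewrite mem_filter mem_monomials -Pk submK // Pm /=; apply/eqP.
    by rewrite -md -{2}(submK km) mdegD addnK.
  case=> m'; rewrite mem_filter mem_monomials => /andP[Pm' /eqP m'd] ->.
  by rewrite Pk Pm' lem_addl mdegD m'd subnK ?eqxx.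
by rewrite (perm_big _ pm) big_map big_filter; apply: eq_bigr => m _; rewrite QD.
Qed.

(** The [L j] are removed one at a time: by coprimality, a factor [L j] does not affect avoidance of
    the others. *)
Lemma mseries_standard (I : finType) (L : I -> 'X_{1..n}) :
  (forall i j v, i != j -> (L i v == 0%N) || (L j v == 0%N)) ->
  mseries (fun m => [forall j, ~~ (L j <= m)%MM]) =
    mseries predT * \prod_j (1 - fpsC (Q (L j)) * fpsX ^+ mdeg (L j)).
Proof.
move=> Lco.
have eq_mseries P P' : P =1 P' -> mseries P = mseries P'.
  by move=> PP'; apply: fpsP => d; apply: eq_bigl.
transitivity (mseries (fun m => all (fun j => ~~ (L j <= m)%MM) (enum I))).
  apply: eq_mseries => m; apply/forallP/allP => [nle j _|nle j]; first exact: nle.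
  by apply: nle; rewrite mem_enum.
rewrite -big_enum /=; elim: (enum I) (enum_uniq I) => [|j s IH] /=.
  by rewrite big_nil mulr1.
case/andP=> js /IH {}IH; rewrite big_cons mulrCA -IH mulrC -mseries_avoid.
  by apply: eq_mseries => m /=; rewrite andbC.
move=> m; apply: eq_in_all => i si.
have ij : i != j by apply: contraNneq js => <-.
congr (~~ _); apply/mnm_lepP/mnm_lepP => le v; move: (le v); rewrite mnmDE.
  by case/orP: (Lco i j v ij) => /eqP->; rewrite ?addn0.
by move/leq_trans; apply; apply: leq_addr.
Qed.

(** The variables are themselves pairwise coprime, and only the monomial 1 is divisible by none of
    them. *)
Lemma mseries_all :
  mseries predT * \prod_(v < n) (1 - fpsC (Q U_(v)%MM) * fpsX) = 1.
Proof.
transitivity (mseries (fun m => [forall v : 'I_n, ~~ (U_(v) <= m)%MM])).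
  rewrite mseries_standard => [|i j v /negbTE ij].
    by congr (_ * _); apply: eq_bigr => v _; rewrite mdeg1 expr1.
  by rewrite !mnm1E; case: (eqVneq i v) ij => // <-; rewrite eq_sym => ->.
have E (m : 'X_{1..n}) : [forall v : 'I_n, ~~ (U_(v) <= m)%MM] = (m == 0%MM).
  apply/forallP/eqP => [nle|-> v]; last by rewrite lep1mP mnm0E.
  by apply/mnmP => v; move: (nle v); rewrite lep1mP mnm0E negbK => /eqP.
apply: fpsP => d; rewrite /= (eq_bigl _ _ E) -big_filter.
have [->|d0] := eqVneq d 0%N; last first.
  rewrite big_filter big_seq_cond big1 // => m /andP[+ /eqP m0].
  by rewrite mem_monomials m0 mdeg0 eq_sym (negbTE d0).
have pm : perm_eq [seq m <- monomials 0 | m == 0%MM] [:: 0%MM].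
  apply: uniq_perm; rewrite ?filter_uniq ?monomials_uniq // => m.
  by rewrite mem_filter mem_monomials mem_seq1 mdeg_eq0 andbb.
by rewrite (perm_big _ pm) big_seq1 Q0.
Qed.

End MonomialSeries.

Lemma fps_unit_linear (A : comNzRingType) (c : A) :
  (1 - fpsC c * fpsX) \is a GRing.unit.
Proof. by apply: fps_unit; rewrite /= big_ord1 /= mulr0 subr0. Qed.

(** * Dimension read off from a basis *)

Section DimensionBasis.
Variables (K : fieldType) (V : lmodType K).
Implicit Types S : set V.

(** Expressing [e] through [e'] gives a matrix with trivial left kernel, hence of rank [k], and it
    has [l] columns. *)
Lemma basis_leq S k l (e : 'I_k -> V) (e' : 'I_l -> V) :
  is_basis S e -> is_basis S e' -> (k <= l)%N.
Proof.
move=> [Se e_free _] [Se' _ e'_gen].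
have [B BE] := boolp.choice (fun i => e'_gen _ (Se i)).
pose M : 'M[K]_(k, l) := \matrix_(i, j) B i j.
suff /eqP <- : row_free M by exact: rank_leq_col.
apply: inj_row_free => v vM; apply/rowP => i; rewrite mxE.
apply: (e_free (v 0)).
under eq_bigr do rewrite BE scaler_sumr.
rewrite exchange_big big1 //= => j _.
under eq_bigr do rewrite scalerA.
rewrite -scaler_suml; move/rowP/(_ j): vM; rewrite !mxE => vM0.
rewrite [X in X *: _](_ : _ = 0) ?scale0r // -[RHS]vM0.
by apply: eq_bigr => i' _; rewrite mxE.
Qed.

Lemma dimension_basis S k (e : 'I_k -> V) : is_basis S e -> dimension S = k.
Proof.
move=> eS; rewrite /dimension; case: xgetP => [l _ [e' e'S]|/(_ k)[]].
  by apply/eqP; rewrite eqn_leq (basis_leq e'S eS) (basis_leq eS e'S).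
by exists e.
Qed.

End DimensionBasis.

(** * The initial monomials of the quadrics *)

Definition lead_col (k : nat) : nat :=
  if odd k then (2 + k./2 %% 3)%N else (k./2 %% 2)%N.

(** In columns 0 and 1 the squares of every other [a] cost 0 while neighbours [a], [a + 1] cost 4.
    In columns 2 to 4 two consecutive residues modulo 3 cost 1 each, so one neighbouring pair in
    three attains the minimum 2. *)
Definition excess (c a : nat) : nat :=
  (if c < 2 then 4 * odd (c + a)
   else if c < 5 then
     if (a %% 3 == c - 2) || (a %% 3 == (c - 1) %% 3) then 1 else 2
   else 4)%N.

(* By convexity, [2 * a ^ 2] favours the products [x_s * x_t] with [s] and [t]
   as close to each other as [s + t] allows; [excess] then singles out the
   column [lead_col (s + t)]. *)
Definition penalty (c a : nat) : nat := (2 * (a * a) + excess c a)%N.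

(** An index [a] occurs only for [2a - 1], [2a], [2a + 1]. Parity separates the middle one; the
    halves [a - 1] and [a] of the others differ modulo 3. *)
Lemma lead_col_inj i j a : a = i./2 \/ a = uphalf i -> a = j./2 \/ a = uphalf j ->
  lead_col i = lead_col j -> i = j.
Proof. by rewrite /lead_col; case: ifP; case: ifP; lia. Qed.

Lemma excess_lead k :
  (excess (lead_col k) k./2 + excess (lead_col k) (uphalf k) = 2 * odd k)%N.
Proof.
rewrite /excess /lead_col uphalf_half; move: (_./2) => a.
case: (odd k); rewrite ?add0n ?add1n; last first.
  have -> : (a %% 2 < 2)%N by lia.
  by have -> : odd (a %% 2 + a) = false by lia.
have -> : (2 + a %% 3 < 2)%N = false by lia.
have -> : (2 + a %% 3 < 5)%N by lia.
by rewrite !ifT; lia.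
Qed.

Lemma excess_gt k c : c <> lead_col k ->
  (2 * odd k < excess c k./2 + excess c (uphalf k))%N.
Proof.
rewrite /excess /lead_col uphalf_half; move: (_./2) => a.
case: (odd k); rewrite ?add0n ?add1n => nc.
  have [c2|c2] := ltnP c 2; first by lia.
  have [c5|c5] := ltnP c 5; last by lia.
  by case: ifP; case: ifP; lia.
have [c2|c2] := ltnP c 2; first by lia.
by have [c5|c5] := ltnP c 5; [case: ifP; lia | lia].
Qed.

(** A balanced pair in a wrong column loses by [excess_gt], an unbalanced pair by the quadratic part
    of the penalty. *)
Lemma penalty_lead c s t :
  (c = lead_col (s + t) -> s <> (s + t)./2 /\ t <> (s + t)./2) ->
  (penalty (lead_col (s + t)) (s + t)./2 +
   penalty (lead_col (s + t)) (uphalf (s + t)) < penalty c s + penalty c t)%N.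
Proof.
wlog st : s t / (s <= t)%N.
  move=> IH nl; have [/IH|/ltnW/IH] := leqP s t; first exact.
  by rewrite (addnC t s) (addnC (penalty c t)); apply=> /nl[].
move=> nl; have := excess_lead (s + t).
have [r sE] : exists r, (s + t)./2 = (s + r)%N.
  by exists ((s + t)./2 - s)%N; lia.
have tE : t = (uphalf (s + t) + r)%N by lia.
have [r0|r0] := posnP r.
  have {}sE : (s + t)./2 = s by lia.
  have {}tE : uphalf (s + t) = t by lia.
  have /excess_gt : c <> lead_col (s + t) by move/nl => -[]; rewrite sE.
  by rewrite sE tE /penalty; lia.
(* The gap is [4 * r * (r + odd (s + t))], at least 4, whereas the leading excess is at most 2. *)
have : (2 * ((s + t)./2 * (s + t)./2) + 2 * (uphalf (s + t) * uphalf (s + t)) + 2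
   < 2 * (s * s) + 2 * (t * t))%N.
  have : uphalf (s + t) = (odd (s + t) + (s + r))%N by rewrite uphalf_half sE.
  rewrite sE; move: tE; move: (uphalf _) => h -> -> {sE st nl}.
  by case: (odd _); nia.
by rewrite /penalty; lia.
Qed.

Lemma mnm_le_mdeg (k : nat) (m : 'X_{1..k}) i : (m i <= mdeg m)%N.
Proof. by rewrite mdegE (bigD1 i) //= leq_addr. Qed.

(** * The quadrics and the standard monomial basis of the quotient *)

Section Quadrics.
Variables (R : realType) (n N1 N2 : nat).
Hypothesis n_ge5 : (5 <= n)%N.
Local Notation V := (AQvar n N1 N2).
Local Notation mon := ('X_{1..#|{: V}|}).
Local Notation U v := (U_(enum_rank (v : V)) : mon)%MM.
Implicit Types m : mon.

Definition pen m : nat :=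
  (\sum_(v : V) m (enum_rank v) * penalty v.1 v.2)%N.

Lemma mnm1_rank (v v' : V) : (U v) (enum_rank v') = (v == v') :> nat.
Proof. by rewrite mnm1E (inj_eq enum_rank_inj). Qed.

Lemma penD m m' : pen (m + m')%MM = (pen m + pen m')%N.
Proof.
by rewrite /pen -big_split; apply: eq_bigr => v _; rewrite mnmDE mulnDl.
Qed.

Lemma penU (v : V) : pen (U v) = penalty v.1 v.2.
Proof.
rewrite /pen (bigD1 v) //= mnm1_rank eqxx mul1n big1 ?addn0 // => v' /negbTE nv.
by rewrite mnm1_rank eq_sym nv.
Qed.

(** Supplies the constant [C] that ends the induction in [unfoldf_onto]. *)
Lemma pen_le m : (pen m <= (\sum_(v : V) penalty v.1 v.2) * mdeg m)%N.
Proof.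
rewrite /pen big_distrl /=; apply: leq_sum => v _.
by rewrite mulnC leq_mul2l mnm_le_mdeg orbT.
Qed.

Lemma mono_weightD m m' : mono_weight (m + m')%MM = mono_weight m + mono_weight m'.
Proof.
rewrite /mono_weight -big_split; apply: eq_bigr => v _.
by rewrite mnmDE PoszD mulrDl.
Qed.

Lemma mono_weightU (v : V) : mono_weight (U v) = wt v.2.
Proof.
rewrite /mono_weight (bigD1 v) //= mnm1_rank eqxx mul1r big1 ?addr0 //.
by move=> v' /negbTE nv; rewrite mnm1_rank eq_sym nv mul0r.
Qed.

Lemma mono_weight0 : mono_weight (0%MM : mon) = 0.
Proof. by rewrite /mono_weight big1 // => v _; rewrite mnm0E mul0r. Qed.

Section Lead.
Variable k : 'I_(2 * N1 + 2 * N2).+1.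

Fact lead_col_proof : (lead_col k < n)%N.
Proof. by rewrite /lead_col; case: ifP; lia. Qed.
Fact half_proof : (k./2 < (N1 + N2).+1)%N.
Proof. by case: k => /= j; lia. Qed.
Fact uphalf_proof : (uphalf k < (N1 + N2).+1)%N.
Proof. by case: k => /= j; lia. Qed.

Definition lead_lo : V := (Ordinal lead_col_proof, Ordinal half_proof).
Definition lead_hi : V := (Ordinal lead_col_proof, Ordinal uphalf_proof).
(** For even [k] the two variables coincide and this is a square. *)
Definition lead : mon := (U lead_lo + U lead_hi)%MM.

Lemma mdeg_lead : mdeg lead = 2%N.
Proof. by rewrite mdegD !mdeg1. Qed.

Lemma lead_neq0 : lead != 0%MM.
Proof. by rewrite -mdeg_eq0 mdeg_lead. Qed.

Lemma mono_weight_lead : mono_weight lead = k%:Z - (2 * N1)%:Z.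
Proof.
rewrite mono_weightD !mono_weightU /wt /=; lia.
Qed.

Lemma lead_supp v : lead (enum_rank v) != 0%N ->
  lead_col k = v.1 /\ (v.2 = k./2 :> nat \/ v.2 = uphalf k :> nat).
Proof.
rewrite mnmDE !mnm1_rank addn_eq0 !eqb0 negb_and !negbK.
by case/orP=> /eqP <-; split => //; [left|right].
Qed.

End Lead.

Lemma lead_coprime i j v : i != j -> (lead i v == 0%N) || (lead j v == 0%N).
Proof.
rewrite -(enum_valK v); move: (enum_val v) => {}v ij.
apply/norP => -[/lead_supp[ci vi] /lead_supp[cj vj]]; case/eqP: ij.
by apply: val_inj; apply: (lead_col_inj vi vj); rewrite ci.
Qed.

Definition quadric (k : 'I_(2 * N1 + 2 * N2).+1) : AQpoly R n N1 N2 :=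
  AQf R n N1 N2 (k%:Z - (2 * N1)%:Z).

(** As a natural number in characteristic 0, the coefficient cannot vanish by cancellation: one term
    suffices. *)
Lemma mcoeff_quadric k m : (quadric k)@_m =
  (\sum_(st : 'I_(N1 + N2).+1 * 'I_(N1 + N2).+1 | (st.1 + st.2)%N == k :> nat)
    \sum_(i < n) (U (i, st.1) + U (i, st.2) == m)%MM)%:R.
Proof.
rewrite /quadric /AQf raddf_sum natr_sum; apply: eq_big => [st|st _].
  by rewrite /wt; apply/eqP/eqP; lia.
rewrite raddf_sum natr_sum; apply: eq_bigr => i _ /=.
by rewrite /lam -mpolyXD mcoeffX.
Qed.

Lemma quadric_supp k m : m \in msupp (quadric k) ->
  exists (i : 'I_n) (s t : 'I_(N1 + N2).+1),
  (s + t)%N = k :> nat /\ m = (U (i, s) + U (i, t))%MM.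
Proof.
rewrite mcoeff_msupp mcoeff_quadric pnatr_eq0 sum_nat_eq0.
case/forallPn=> -[s t]; rewrite negb_imply /= => /andP[/eqP stk].
case: (pickP (fun i => (U (i, s) + U (i, t))%MM == m)) => [i /eqP <-|no].
  by exists i, s, t.
by rewrite big1 // => i _; rewrite no.
Qed.

Lemma mcoeff_quadric_lead k : (quadric k)@_(lead k) != 0.
Proof.
rewrite mcoeff_quadric pnatr_eq0 -lt0n.
rewrite (bigD1 ((lead_lo k).2, (lead_hi k).2)) /=; last by lia.
by rewrite (bigD1 (lead_lo k).1) //= eqxx.
Qed.

Lemma quadric_initial k : initial pen (@mono_weight n N1 N2) (quadric k) (lead k).
Proof.
split; first exact: mcoeff_quadric_lead.
move=> _ /quadric_supp[i [s [t [stk ->]]]].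
have [//|nlead] := eqVneq; rewrite /above !mdegD !mdeg1 eqxx /=.
rewrite mono_weight_lead mono_weightD !mono_weightU !penD !penU /=.
apply/andP; split; first by rewrite /wt /=; lia.
rewrite -stk; apply: penalty_lead => ic; rewrite stk in ic *.
have iE : i = (lead_lo k).1 by apply: val_inj.
(* In the leading column, one index equal to the lower half fixes the other, and the monomial is
   [lead k]. *)
split=> sE; case/eqP: nlead.
  have -> : s = (lead_lo k).2 by apply: val_inj.
  have -> : t = (lead_hi k).2 by apply: val_inj => /=; lia.
  by rewrite iE.
have -> : t = (lead_lo k).2 by apply: val_inj.
have -> : s = (lead_hi k).2 by apply: val_inj => /=; lia.
by rewrite iE addmC.
Qed.

Lemma AQpiZ a (p : AQpoly R n N1 N2) : AQpi (a *: p) = a *: AQpi p.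
Proof. by rewrite -mul_mpolyC rmorphM. Qed.

Lemma AQpi_eq0 (p : AQpoly R n N1 N2) :
  AQpi p = 0 <-> exists c, p = \sum_k c k * quadric k.
Proof.
rewrite -(rmorph0 (@AQpi R n N1 N2)); split=> [/eqP|[c pE]].
  by rewrite -[_ == _]Quotient.idealrBE subr0 => /asboolP[c ->]; exists c.
apply/eqP; rewrite -[_ == _]Quotient.idealrBE subr0.
by apply/asboolP; exists c.
Qed.

Definition std_monomials d w : seq mon :=
  [seq m <- monomials #|{: V}| d | standard lead m && (mono_weight m == w)].

(** Independence comes from [standard_ideal], generation from [standard_reduction]. *)
Lemma std_monomials_basis d w :
  is_basis (AQcomp (R := R) (n := n) (N1 := N1) (N2 := N2) d w)
    (fun i : 'I_(size (std_monomials d w)) =>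
      AQpi ('X_[nth 0%MM (std_monomials d w) i] : AQpoly R n N1 N2)).
Proof.
set s := std_monomials d w.
have s_uniq : uniq s by rewrite filter_uniq ?monomials_uniq.
have sP m : m \in s -> [/\ mdeg m = d, mono_weight m = w & standard lead m].
  rewrite mem_filter mem_monomials => /andP[/andP[-> /eqP->] /eqP->].
  by split.
have comb (c : 'I_(size s) -> R[i]) :
    \sum_i c i *: AQpi ('X_[nth 0%MM s i] : AQpoly R n N1 N2) =
    AQpi (\sum_i c i *: 'X_[nth 0%MM s i]).
  by rewrite raddf_sum; apply: eq_bigr => i _; rewrite /= AQpiZ.
split.
- move=> i; exists 'X_[nth 0%MM s i] => // m; rewrite msuppX mem_seq1 => /eqP->.
  by have [] := sP _ (mem_nth 0%MM (ltn_ord i)).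
- move=> c; rewrite comb => /AQpi_eq0[e].
  set p := \sum_i _ => pE i.
  have p0 : p = 0.
    apply: (standard_ideal penD mono_weightD pen_le lead_neq0 lead_coprime
      quadric_initial _ pE) => m /msupp_sum_le/flattenP[s' /mapP[j _ ->]].
    move/msuppZ_le; rewrite msuppX mem_seq1 => /eqP->.
    by have [] := sP _ (mem_nth 0%MM (ltn_ord j)).
  move/(congr1 (mcoeff (nth 0%MM s i))): p0; rewrite mcoeff0 raddf_sum /=.
  rewrite (bigD1 i) //= mcoeffZ mcoeffX eqxx mulr1 big1 ?addr0 // => j ji.
  by rewrite mcoeffZ mcoeffX nth_uniq // (inj_eq val_inj) (negbTE ji) mulr0.
move=> _ [p pd <-].
have [q [e [qd qS ->]]] := standard_reduction penD mono_weightD pen_le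
  lead_neq0 lead_coprime quadric_initial pd.
exists (fun i => q@_(nth 0%MM s i)); rewrite comb rmorphD /=.
have -> : AQpi (\sum_j e j * quadric j) = 0 by apply/AQpi_eq0; exists e.
rewrite addr0; congr AQpi.
(* The support of [q] lies in [s], and the other coefficients vanish. *)
rewrite -(big_mkord predT (fun i => q@_(nth 0%MM s i) *: 'X_[nth 0%MM s i])).
rewrite -(big_nth 0%MM predT (fun m => q@_m *: 'X_[m])) /= {1}[q]mpolyE.
rewrite [RHS](bigID (fun m => m \in msupp q)) /= [X in _ + X]big1 => [|m].
  rewrite addr0 -[RHS]big_filter; apply: perm_big.
  apply: uniq_perm => [||m]; [exact: msupp_uniq | exact: filter_uniq |].
  rewrite mem_filter mem_filter mem_monomials.
  case: (boolP (m \in msupp q)) => // mq; case: (qd m mq) => -> ->.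
  by rewrite qS // !eqxx.
by move/memN_msupp_eq0 ->; rewrite scale0r.
Qed.

(** * From standard monomials to the generating function *)

Definition lqw m : laurent := lq ^ mono_weight m.

Lemma lqwD m m' : lqw (m + m')%MM = lqw m * lqw m'.
Proof. by rewrite /lqw mono_weightD exprzDr ?lq_unit. Qed.

Lemma AQgf_standard : AQgf R n N1 N2 = mseries lqw (standard lead).
Proof.
apply: fpsP => d; rewrite /AQgf /=.
(* A weight outside [ws] has no monomial of degree [d], hence dimension 0, so the sum over all
   weights is finite. *)
pose ws := undup [seq mono_weight m | m <- monomials #|{: V}| d].
rewrite (fsbigE ws) ?undup_uniq // => [|w _ wN]; last first.
  rewrite (dimension_basis (std_monomials_basis d w)).
  rewrite /std_monomials size_filter; apply/eqP.
  rewrite (_ : count _ _ = 0%N) ?mul0r //.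
  apply/eqP; rewrite -leqn0 leqNgt -has_count.
  apply: contra wN => /hasP[m md /andP[_ /eqP <-]].
  by rewrite mem_undup; apply: map_f.
under eq_bigl do rewrite in_setT.
rewrite -[RHS]big_filter.
transitivity (\sum_(w <- ws) \sum_(m <- std_monomials d w) lqw m).
  apply: eq_bigr => w _; rewrite (dimension_basis (std_monomials_basis d w)).
  rewrite -sum1_size natr_sum mulr_suml; apply: eq_big_seq => m.
  by rewrite mem_filter => /andP[/andP[_ /eqP mw] _]; rewrite mul1r /lqw mw.
under [LHS]eq_bigr do rewrite /std_monomials big_filter.
rewrite (exchange_big_dep (standard lead)) /= => [|w m _ /andP[]//].
rewrite -[LHS]big_filter; apply: eq_big_seq => m.
rewrite mem_filter => /andP[st md].
under eq_bigl do rewrite st eq_sym /=.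
rewrite -big_filter filter_pred1_uniq ?undup_uniq ?big_seq1 //.
by rewrite mem_undup; apply: map_f.
Qed.

End Quadrics.

Theorem proposition15 (R : realType) (n N1 N2 : nat) (hn : (5 <= n)%N) :
  AQgf R n N1 N2 =
    (\prod_(l < (2 * N1 + 2 * N2).+1)
       (1 - fpsC (lq ^ (l%:Z - (2 * N1)%:Z)) * fpsX ^+ 2)) /
    (\prod_(l < (N1 + N2).+1)
       (1 - fpsC (lq ^ (l%:Z - N1%:Z)) * fpsX) ^+ n).
Proof.
have lqw0 : lqw (0%MM : 'X_{1..#|{: AQvar n N1 N2}|}) = 1.
  by rewrite /lqw mono_weight0.
(* The series of all monomials inverts the denominator; grouping the variables by index [s] gives
   the [n]-th powers. *)
have all1 : mseries (@lqw n N1 N2) predT *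
    \prod_(l < (N1 + N2).+1) (1 - fpsC (lq ^ (l%:Z - N1%:Z)) * fpsX) ^+ n = 1.
  rewrite -[RHS](mseries_all (@lqwD n N1 N2) lqw0); congr (_ * _).
  rewrite (reindex (@enum_rank (AQvar n N1 N2))) /=; last first.
    by exists enum_val => v _; [apply: enum_rankK | apply: enum_valK].
  under [RHS]eq_bigr do rewrite /lqw mono_weightU.
  rewrite -(pair_bigA _ (fun i s => 1 - fpsC (lq ^ wt s) * fpsX)) /=.
  by rewrite exchange_big; apply: eq_bigr => s _; rewrite prodr_const card_ord.
(* The denominator is a unit, so the division can be cleared. *)
apply: canRL (mulrK _) _.
  by apply: rpred_prod => l _; apply/unitrX/fps_unit_linear.
rewrite (AQgf_standard R N1 N2 hn) (mseries_standard (@lqwD n N1 N2) (lead_coprime hn)).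
rewrite mulrAC all1 mul1r.
by apply: eq_bigr => k _; rewrite mdeg_lead /lqw mono_weight_lead.
Qed.
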